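(* Let $\mathbf E=(E_x,E_y,E_z)$ and $\mathbf H=(H_x,H_y,H_z)$ be a ($C^3$ on $[0,T]\times\overline\Omega$) solution of the Maxwell equations in a lossless and isotropic medium, $$\varepsilon\,\frac{\partial \mathbf E}{\partial t}=\nabla\times\mathbf H,\qquad \mu\,\frac{\partial \mathbf H}{\partial t}=-\nabla\times\mathbf E\qquad\text{in }(0,T]\times\Omega ,$$ satisfying the perfectly electric conducting (PEC) boundary conditions $\vec n\times\mathbf E=0$ and $\vec n\cdot\mathbf H=0$ on $(0,T]\times\partial\Omega$. Then for each $w\in\{x,y,z\}$ the quantity $$\int_\Omega\left(\varepsilon\left|\frac{\partial^2\mathbf E}{\partial w\,\partial t}\right|^2+\mu\left|\frac{\partial^2\mathbf H}{\partial w\,\partial t}\right|^2\right)dx\,dy\,dz$$ is constant in time on $[0,T]$.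
   Context: $\Omega=[0,1]\times[0,1]\times[0,1]$ is the unit cube, $T>0$, and $\vec n$ is the outward unit normal of $\partial\Omega$. The electric permittivity $\varepsilon>0$ and the magnetic permeability $\mu>0$ are constants (lossless isotropic medium, zero conductivity, no source). $|\cdot|$ is the Euclidean norm in $\mathbb R^3$ and derivatives of vector fields are taken componentwise. The boundary condition $\vec n\times\mathbf E=0$, $\vec n\cdot\mathbf H=0$ is imposed on each open face of the cube; equivalently, $E_y=E_z=H_x=0$ for $x\in\{0,1\}$, $E_x=E_z=H_y=0$ for $y\in\{0,1\}$, and $E_x=E_y=H_z=0$ for $z\in\{0,1\}$. *)

(* Defs.v *)
From mathcomp Require Export all_boot all_order all_algebra.
From mathcomp Require Export all_classical all_reals all_analysis.
From mathcomp Require Export measurable_realfun.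

Set Implicit Arguments.
Unset Strict Implicit.
Unset Printing Implicit Defensive.

Export Order.TTheory GRing.Theory Num.Theory.
Export numFieldNormedType.Exports.

Local Open Scope classical_set_scope.
Local Open Scope ring_scope.

(* The difference quotient of f at p in the i-th direction only uses the
   increments h that keep the point in D.  On a box the limit is therefore the
   ordinary partial derivative at interior points and the one-sided one on
   the faces, and never depends on values of f outside the box. *)

Definition diff_quot (R : realType) (n : nat) (i : 'I_n)
    (f : 'rV[R]_n -> R) (p : 'rV[R]_n) (h : R) : R :=
  h^-1 * (f (p + h *: delta_mx 0 i) - f p).

Definition increments (R : realType) (n : nat) (D : set 'rV[R]_n) (i : 'I_n)
    (p : 'rV[R]_n) : set R :=
  [set h | D (p + h *: delta_mx 0 i)].

Definition has_partial (R : realType) (n : nat) (D : set 'rV[R]_n) (i : 'I_n)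
    (f : 'rV[R]_n -> R) (p : 'rV[R]_n) : Prop :=
  cvg (diff_quot i f p h @[h --> within (increments D i p) 0^']).

Definition partial (R : realType) (n : nat) (D : set 'rV[R]_n) (i : 'I_n)
    (f : 'rV[R]_n -> R) (p : 'rV[R]_n) : R :=
  lim (diff_quot i f p h @[h --> within (increments D i p) 0^']).

(* All iterated partial derivatives of order at most k, in every order of
   differentiation, exist at each point of D and are continuous on D. *)
Fixpoint Ck (R : realType) (n : nat) (k : nat) (D : set 'rV[R]_n)
    (f : 'rV[R]_n -> R) : Prop :=
  {within D, continuous f} /\
  match k with
  | 0 => True
  | k'.+1 => forall i : 'I_n,
      (forall p, D p -> has_partial D i f p) /\ Ck k' D (partial D i f)
  end.

Definition vpartial (R : realType) (n m : nat) (D : set 'rV[R]_n) (i : 'I_n)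
    (F : 'rV[R]_n -> 'rV[R]_m) (p : 'rV[R]_n) : 'rV[R]_m :=
  \row_j partial D i (fun q => F q 0 j) p.

Definition vCk (R : realType) (n m : nat) (k : nat) (D : set 'rV[R]_n)
    (F : 'rV[R]_n -> 'rV[R]_m) : Prop :=
  forall j : 'I_m, Ck k D (fun q => F q 0 j).

(* The coordinates x, y, z are indexed by 0, 1, 2 : 'I_3, and index
   arithmetic in 'I_3 is modulo 3. *)

(* The library norm of a matrix is the sup norm, hence this definition. *)
Definition enorm (R : realType) (v : 'rV[R]_3) : R :=
  Num.sqrt (\sum_(i < 3) v 0 i ^+ 2).

Definition crossp (R : realType) (u v : 'rV[R]_3) : 'rV[R]_3 :=
  \row_k (u 0 (k + 1) * v 0 (k + 2) - u 0 (k + 2) * v 0 (k + 1)).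

Definition dotp (R : realType) (u v : 'rV[R]_3) : R :=
  \sum_(i < 3) u 0 i * v 0 i.

Definition cube (R : realType) : set 'rV[R]_3 :=
  [set x | forall i, 0 <= x 0 i <= 1].

(* The open face x_i = 0 (b = false) or x_i = 1 (b = true). *)
Definition open_face (R : realType) (i : 'I_3) (b : bool) : set 'rV[R]_3 :=
  [set x | x 0 i = b%:R /\ forall j, j != i -> 0 < x 0 j < 1].

Definition outward_normal (R : realType) (i : 'I_3) (b : bool) : 'rV[R]_3 :=
  (if b then 1 else -1) *: delta_mx 0 i.

(* Lebesgue measure on R^3 lives on (R * R) * R, hence the conversion. *)
Definition pt3 (R : realType) (a : R * R * R) : 'rV[R]_3 :=
  \row_(i < 3) [:: a.1.1; a.1.2; a.2]`_i.

(* A space-time point of R^(1+3) has the time as its first coordinate. *)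

Definition txyz (R : realType) (t : R) (x : 'rV[R]_3) : 'rV[R]_(1 + 3) :=
  row_mx t%:M x.

Definition time_idx : 'I_(1 + 3) := lshift 3 0.
Definition space_idx (w : 'I_3) : 'I_(1 + 3) := rshift 1 w.

Definition cylinder (R : realType) (T : R) : set 'rV[R]_(1 + 3) :=
  [set p | 0 <= lsubmx p 0 0 <= T /\ cube (rsubmx p)].

Definition curl (R : realType) (D : set 'rV[R]_(1 + 3))
    (F : 'rV[R]_(1 + 3) -> 'rV[R]_3) (p : 'rV[R]_(1 + 3)) : 'rV[R]_3 :=
  \row_k (partial D (space_idx (k + 1)) (fun q => F q 0 (k + 2)) p
          - partial D (space_idx (k + 2)) (fun q => F q 0 (k + 1)) p).

Definition maxwell (R : realType) (T eps mu : R)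
    (E H : 'rV[R]_(1 + 3) -> 'rV[R]_3) : Prop :=
  forall (t : R) (x : 'rV[R]_3), 0 < t <= T -> cube x ->
    let D := cylinder T in
    eps *: vpartial D time_idx E (txyz t x) = curl D H (txyz t x) /\
    mu *: vpartial D time_idx H (txyz t x) = - curl D E (txyz t x).

Definition pec (R : realType) (T : R)
    (E H : 'rV[R]_(1 + 3) -> 'rV[R]_3) : Prop :=
  forall (t : R) (i : 'I_3) (b : bool) (x : 'rV[R]_3),
    0 < t <= T -> open_face i b x ->
    crossp (outward_normal R i b) (E (txyz t x)) = 0 /\
    dotp (outward_normal R i b) (H (txyz t x)) = 0.

(* The mixed derivative is d/dw (d/dt F). *)
Definition energy_wt (R : realType) (T eps mu : R)
    (E H : 'rV[R]_(1 + 3) -> 'rV[R]_3) (w : 'I_3) (t : R) : \bar R :=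
  let D := cylinder T in
  (\int[@lebesgue_measure R \x @lebesgue_measure R
         \x @lebesgue_measure R]_(a in [set a | cube (pt3 a)])
    (eps * enorm (vpartial D (space_idx w) (vpartial D time_idx E)
                    (txyz t (pt3 a))) ^+ 2
     + mu * enorm (vpartial D (space_idx w) (vpartial D time_idx H)
                     (txyz t (pt3 a))) ^+ 2)%:E)%E.

(* Main.v *)
Require Import Defs.
From HB Require Import structures.
From mathcomp Require Import all_boot all_order all_algebra.
From mathcomp Require Import all_classical all_reals all_analysis.
From mathcomp Require Import ring lra.
Import Order.TTheory GRing.Theory Num.Theory numFieldNormedType.Exports.
Set Implicit Arguments.
Unset Strict Implicit.
Unset Printing Implicit Defensive.
Local Open Scope classical_set_scope.
Local Open Scope ring_scope.

(** Put A = d_w d_t E and B = d_w d_t H.  Maxwell's equations are linear with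
    constant coefficients, so they may be differentiated in t and in w; once
    the derivatives are interchanged ([schwarz], on the closed cylinder), A and
    B solve the same equations as E and H, eps d_t A = curl B and
    mu d_t B = - curl A ([ampere_wt], [faraday_wt]).  This uses exactly the
    three derivatives that the fields have.  The energy density
    eps |A|^2 + mu |B|^2 therefore satisfies Poynting's identity: its time
    derivative is the divergence of -2 A x B ([poynting]).  Integrating over
    the cube leaves the flux of A x B through the faces, and the point is that
    this flux vanishes.

    On a face with normal direction m the flux only sees the components of A
    and B tangential to the face.  If m <> w, then d_w and d_t are both
    derivatives along the face, on which the tangential part of E is zero, so
    the tangential part of A is zero ([tangential_A]).  If m = w, then d_w is
    the normal derivative and says nothing about A; here it is the tangential
    part of B that vanishes.  Indeed Ampere's law expresses the normal
    derivatives of the tangential components of H through d_t of the tangential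
    components of E and tangential derivatives of the normal component of H,
    all of which vanish on the face by the boundary conditions
    ([tangential_B]).

    The analytic part is [conservation_law]: a continuous density whose time
    derivative is a divergence with vanishing normal fluxes has a constant
    integral.  It is proved without differentiating under the integral sign:
    by the fundamental theorem of calculus the increment of the integral
    between times 0 and t is a space-time integral of the divergence, and by
    Fubini's theorem each term of it can be integrated first along its own
    direction, where it gives a difference of two face values, i.e. zero.

    The equations and boundary conditions are given for t > 0, and the latter
    on open faces only; they extend to the closed cylinder by continuity along
    segments ([segment_limit]). *)

(** * Closed boxes and differentiation along coordinate lines *)

Section box.
Context {R : realType} {n : nat}.
Implicit Types (L : 'I_n -> R) (p q : 'rV[R]_n) (f g : 'rV[R]_n -> R)
  (i j : 'I_n) (s : R).

Definition box L : set 'rV[R]_n := [set p | forall i, 0 <= p 0 i <= L i].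

(** The lines p + s e_i are parametrized by the displacement s, as in the
    difference quotients that define the partial derivatives. *)
Definition slide p i s : 'rV[R]_n := p + s *: delta_mx 0 i.

(** The nearest-point projection onto the box.  Composing with it turns a
    function that is continuous on the box into a function that is continuous
    everywhere, without changing its values on the box; this is how continuity
    on the box gives measurability and boundedness on the whole space. *)
Definition clamp L p : 'rV[R]_n :=
  \row_i Num.max 0 (Num.min (L i) (p 0 i)).

Lemma slideE p i s j : slide p i s 0 j = p 0 j + (if j == i then s else 0).
Proof.
by rewrite !mxE eqxx /=; case: eqVneq => _; rewrite ?mulr1 ?mulr0.
Qed.

Lemma slide0 p i : slide p i 0 = p.
Proof. by rewrite /slide scale0r addr0. Qed.

Lemma slideD p i s s' : slide (slide p i s) i s' = slide p i (s + s').
Proof. by rewrite /slide -addrA -scalerDl. Qed.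

Lemma slideC p i j s s' :
  slide (slide p i s) j s' = slide (slide p j s') i s.
Proof. by rewrite /slide -!addrA [X in _ + X]addrC. Qed.

Lemma box_slide L p i a b s : box L (slide p i a) -> box L (slide p i b) ->
  a <= s <= b -> box L (slide p i s).
Proof.
move=> Da Db /andP[as_ sb] j; move: (Da j) (Db j); rewrite !slideE.
by case: eqP => _ //; lra.
Qed.

Lemma cvg_rowP {T : Type} (F : set_system T) {FF : Filter F}
    (u : T -> 'rV[R]_n) q :
  (forall j, u x 0 j @[x --> F] --> q 0 j) -> u @ F --> q.
Proof.
move=> uq; apply/cvg_ballP => e e0.
suff : \forall x \near F, forall j, ball (q 0 j) e (u x 0 j).
  apply: filterS => x Hx; split => // i j.
  by rewrite (ord1 i); exact: Hx.
apply: filter_forall => j.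
by move/cvg_ballP : (uq j) => /(_ e e0).
Qed.

Lemma continuous_slide p i : continuous (slide p i).
Proof.
move=> s; apply: (@cvg_rowP _ (nbhs s)) => j.
rewrite slideE (_ : (fun x => _) = fun x => p 0 j + (if j == i then x else 0)).
  case: eqP => _; last exact: cvg_cst.
  by apply: cvgD; [exact: cvg_cst|exact: cvg_id].
by apply/funext => x; rewrite slideE.
Qed.

Lemma continuous_clamp L : continuous (clamp L).
Proof.
move=> p; apply: (@cvg_rowP _ (nbhs p)) => j; rewrite mxE.
rewrite (_ : (fun x => _) =
  fun x : 'rV[R]_n => Num.max 0 (Num.min (L j) (x 0 j))); last first.
  by apply/funext => x; rewrite mxE.
apply: (continuous_comp (f := fun x : 'rV[R]_n => x 0 j)
  (g := fun r => Num.max 0 (Num.min (L j) r))); first exact: coord_continuous.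
move: (p 0 j) => r.
apply: (@continuous_max _ _ (cst 0) (fun r => Num.min (L j) r)) => //.
  exact: cst_continuous.
apply: (@continuous_min _ _ (cst (L j)) id) => //.
exact: cst_continuous.
Qed.

Lemma clamp_box L p : (forall i, 0 <= L i) -> box L (clamp L p).
Proof.
by move=> L0 i; rewrite mxE le_max lexx /= ge_max L0 /= ge_min lexx.
Qed.

Lemma clamp_id L p : box L p -> clamp L p = p.
Proof.
move=> Dp; apply/rowP => i; rewrite mxE; have /andP[? ?] := Dp i.
by rewrite min_r ?max_r.
Qed.

Lemma continuous_comp_clamp L f : (forall i, 0 <= L i) ->
  {within box L, continuous f} -> continuous (f \o clamp L).
Proof.
move=> L0 /subspace_continuousP cf p.
move=> A /(cf _ (clamp_box p L0)) fA.
have : nbhs p (clamp L @^-1` [set x | box L x -> A (f x)]).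
  exact: (@continuous_clamp L p _ fA).
change (nbhs p (clamp L @^-1` [set x | box L x -> A (f x)]) ->
  nbhs p ((f \o clamp L) @^-1` A)).
by apply: filterS => x /= xA; apply: xA; exact: clamp_box.
Qed.

Lemma within_continuous_slide L p i f a b : (forall j, 0 <= L j) ->
  {within box L, continuous f} ->
  box L (slide p i a) -> box L (slide p i b) ->
  {within `[a, b], continuous (fun s => f (slide p i s))}.
Proof.
move=> L0 cf Da Db.
apply: (@subspace_eq_continuous _ _ _ (fun s => (f \o clamp L) (slide p i s))).
  move=> s /set_mem /=; rewrite in_itv /= => sab.
  by rewrite clamp_id//; exact: box_slide Da Db sab.
apply: continuous_subspaceT => s.
apply: (continuous_comp (f := slide p i)); first exact: continuous_slide.
exact: continuous_comp_clamp.
Qed.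

(** Only points in the open range of the coordinate i are asked for, so that
    these are two-sided derivatives of functions of one real variable, and the
    usual rules apply.  The mean value theorem and the fundamental theorem of
    calculus ask for no more than this, given continuity up to the faces. *)
Definition line_derivative L i f g := forall p, box L p ->
  0 < p 0 i < L i -> is_derive (0 : R) 1 (fun s => f (slide p i s)) (g p).

Lemma line_derivative_slide L i f g p s : line_derivative L i f g ->
  box L (slide p i s) -> 0 < slide p i s 0 i < L i ->
  is_derive s 1 (fun r => f (slide p i r)) (g (slide p i s)).
Proof.
move=> fg Ds ps.
have [] := fg _ Ds ps; rewrite /derivable /derive.
have -> : (fun h : R => h^-1 *: (((fun r => f (slide (slide p i s) i r)) \o
      shift 0) (h *: 1) - f (slide (slide p i s) i 0))) =
    (fun h : R => h^-1 *: (((fun r => f (slide p i r)) \o shift s) (h *: 1)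
      - f (slide p i s))).
  by apply/funext => h; rewrite /= !slideD !addr0 [s + _]addrC.
by move=> ? ?; split.
Qed.

Lemma is_derive_slide L i f g p a b s : line_derivative L i f g ->
  box L (slide p i a) -> box L (slide p i b) -> s \in `]a, b[ ->
  is_derive s 1 (fun r => f (slide p i r)) (g (slide p i s)).
Proof.
move=> fg Da Db; rewrite in_itv /= => /andP[as_ sb].
apply: (line_derivative_slide (L := L)) => //.
  by apply: (box_slide Da Db); rewrite !ltW.
by have := Da i; have := Db i; rewrite !slideE eqxx; lra.
Qed.

Lemma line_FTC L i f g p a b : (forall j, 0 <= L j) ->
  {within box L, continuous f} -> {within box L, continuous g} ->
  line_derivative L i f g ->
  box L (slide p i a) -> box L (slide p i b) -> a < b ->
  (\int[lebesgue_measure]_(s in `[a, b]) (g (slide p i s))%:E =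
   (f (slide p i b))%:E - (f (slide p i a))%:E)%E.
Proof.
move=> L0 cf cg fg Da Db ab.
apply: (@continuous_FTC2 R (fun s => g (slide p i s))
  (fun s => f (slide p i s)) a b ab).
- exact: within_continuous_slide.
- have := within_continuous_slide L0 cf Da Db.
  move/(continuous_within_itvP _ ab) => [_ ? ?]; split => //.
  by move=> s sab; have [] := is_derive_slide fg Da Db sab.
- move=> s sab; have := is_derive_slide fg Da Db sab => ?.
  by rewrite derive1E derive_val.
Qed.

End box.

Section continuity_rules.
Context {R : realType} {n : nat}.
Variables (D : set 'rV[R]_n).
Implicit Types (f g : 'rV[R]_n -> R).
Local Notation cont f := {within D, continuous f}.

Lemma within_continuousD f g : cont f -> cont g -> cont (fun p => f p + g p).
Proof.
move=> /subspace_continuousP cf /subspace_continuousP cg.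
by apply/subspace_continuousP => p Dp; apply: cvgD; [exact: cf|exact: cg].
Qed.

Lemma within_continuousB f g : cont f -> cont g -> cont (fun p => f p - g p).
Proof.
move=> /subspace_continuousP cf /subspace_continuousP cg.
by apply/subspace_continuousP => p Dp; apply: cvgB; [exact: cf|exact: cg].
Qed.

Lemma within_continuousM f g : cont f -> cont g -> cont (fun p => f p * g p).
Proof.
move=> /subspace_continuousP cf /subspace_continuousP cg.
by apply/subspace_continuousP => p Dp; apply: cvgM; [exact: cf|exact: cg].
Qed.

Lemma within_continuousZ f c : cont f -> cont (fun p => c * f p).
Proof.
move=> /subspace_continuousP cf.
by apply/subspace_continuousP => p Dp; apply: cvgM; [exact: cvg_cst|exact: cf].
Qed.

Lemma within_continuous_sum (I : finType) (F : I -> 'rV[R]_n -> R) :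
  (forall j, cont (F j)) -> cont (fun p => \sum_j F j p).
Proof.
move=> cF; apply/subspace_continuousP => p Dp.
apply: cvg_big => [|j _]; first exact: add_continuous.
by have /subspace_continuousP := cF j; exact.
Qed.

End continuity_rules.

Section line_derivative_rules.
Context {R : realType} {n : nat}.
Variables (L : 'I_n -> R) (i : 'I_n).
Implicit Types (f g df dg : 'rV[R]_n -> R).
Local Notation ld := (line_derivative L i).

Lemma eq_line_derivative f df dg : (forall p, box L p -> df p = dg p) ->
  ld f df -> ld f dg.
Proof. by move=> fg fd p Dp pi; rewrite -fg//; exact: fd. Qed.

Lemma line_derivativeD f g df dg : ld f df -> ld g dg ->
  ld (fun p => f p + g p) (fun p => df p + dg p).
Proof. by move=> fd gd p Dp pi; exact: (is_deriveD (fd p Dp pi) (gd p Dp pi)). Qed.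

Lemma line_derivativeB f g df dg : ld f df -> ld g dg ->
  ld (fun p => f p - g p) (fun p => df p - dg p).
Proof. by move=> fd gd p Dp pi; exact: (is_deriveB (fd p Dp pi) (gd p Dp pi)). Qed.

Lemma line_derivativeZ f df c : ld f df -> ld (fun p => c * f p) (fun p => c * df p).
Proof. by move=> fd p Dp pi; exact: (is_deriveZ c (fd p Dp pi)). Qed.

Lemma line_derivativeM f g df dg : ld f df -> ld g dg ->
  ld (fun p => f p * g p) (fun p => f p * dg p + g p * df p).
Proof.
move=> fd gd p Dp pi; have := is_deriveM (fd p Dp pi) (gd p Dp pi).
by rewrite slide0.
Qed.

Lemma line_derivative_sum m (F dF : 'I_m -> 'rV[R]_n -> R) :
  (forall j, ld (F j) (dF j)) ->
  ld (fun p => \sum_j F j p) (fun p => \sum_j dF j p).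
Proof.
move=> FdF p Dp pi.
have := is_derive_sum (fun j => FdF j p Dp pi).
by rewrite fct_sumE.
Qed.

End line_derivative_rules.

(** * Partial derivatives on a box *)

Section partial.
Context {R : realType} {n : nat}.
Implicit Types (L : 'I_n -> R) (p q : 'rV[R]_n) (f g : 'rV[R]_n -> R)
  (i j : 'I_n) (s : R).

(** Uniqueness of the limits defining partial derivatives: since the box has
    positive width in the direction i, arbitrarily small nonzero increments of
    at least one sign stay in it. *)
Lemma increments_proper L i p : 0 < L i -> box L p ->
  ProperFilter (within (increments (box L) i p) (0 : R)^').
Proof.
move=> L0 Dp; apply: Build_ProperFilter_ex => A; rewrite /within /=.
move=> /nbhs_ballP[e /= e0 eA].
pose m := Num.min e (L i) / 2.
have m0 : 0 < m by rewrite divr_gt0// lt_min e0.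
have [me mL] : m < e /\ m <= L i / 2.
  have : Num.min e (L i) <= e /\ Num.min e (L i) <= L i.
    by rewrite !ge_min !lexx /= orbT.
  by rewrite /m; lra.
have pi := Dp i.
(* go up from the lower half of the box and down from the upper half *)
have [pL|pL] := leP (p 0 i) (L i / 2).
- exists m; apply: eA.
  + by rewrite /ball /= sub0r normrN gtr0_norm.
  + by rewrite gt_eqF.
  + move=> j; rewrite -/(slide p i m) slideE.
    by case: eqP => [->|_]; [lra|rewrite addr0].
- exists (- m); apply: eA.
  + by rewrite /ball /= sub0r opprK gtr0_norm.
  + by rewrite lt_eqF// oppr_lt0.
  + move=> j; rewrite -/(slide p i _) slideE.
    by case: eqP => [->|_]; [lra|rewrite addr0].
Qed.

(** At a point in the open range of the coordinate i, all small increments stay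
    in the box, so the restricted limit is the unrestricted one. *)
Lemma has_partial_line_derivative L i f :
  (forall p, box L p -> has_partial (box L) i f p) ->
  line_derivative L i f (partial (box L) i f).
Proof.
move=> fD p Dp pi; have := fD _ Dp; rewrite /has_partial.
have FE : within (increments (box L) i p) (0 : R)^' = (0 : R)^'.
  have inc : \forall h \near (0 : R)^', increments (box L) i p h.
    apply: nbhs_dnbhs.
    apply/nbhs_ballP; exists (Num.min (p 0 i) (L i - p 0 i)) => /=.
      by rewrite lt_min subr_gt0.
    move=> h; rewrite /ball /= sub0r normrN lt_min !ltr_norml => hp j.
    rewrite -/(slide p i _) slideE; case: eqP => [->|_]; first by lra.
    by rewrite addr0.
  rewrite eqEsubset; split => A.
    by rewrite /within /= => HA; apply: filterS2 inc HA => h hi; exact.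
  by rewrite /within /=; apply: filterS => h Ah _.
have dE : diff_quot i f p =
    (fun h : R => h^-1 *: (((fun r => f (slide p i r)) \o shift 0) (h *: 1)
      - f (slide p i 0))).
  apply/funext => h; rewrite /diff_quot slide0 /= addr0.
  by congr (_ * (f _ - _)); rewrite /slide [_ *: 1]mulr1.
by rewrite /partial FE dE => ?; split.
Qed.

Lemma eq_partial L i f g p : box L p -> (forall q, box L q -> f q = g q) ->
  partial (box L) i f p = partial (box L) i g p.
Proof.
move=> Dp fg; rewrite /partial; congr (lim _).
have E h : increments (box L) i p h -> diff_quot i f p h = diff_quot i g p h.
  by move=> hD; rewrite /diff_quot !fg.
by rewrite eqEsubset; split;
  apply: (@fmap_within_eq _ _ _ (0 : R)^') => h /set_mem hD; rewrite E.
Qed.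

Lemma partialZ L i f c p : 0 < L i -> box L p -> has_partial (box L) i f p ->
  partial (box L) i (fun q => c * f q) p = c * partial (box L) i f p.
Proof.
move=> L0 Dp fp; have PF := increments_proper L0 Dp.
apply: cvg_lim => //.
have -> : diff_quot i (fun q => c * f q) p = (fun h => c * diff_quot i f p h).
  by apply/funext => h; rewrite /diff_quot -mulrBr mulrCA.
by apply: cvgM; [exact: cvg_cst|exact: fp].
Qed.

Lemma partialB L i f g p : 0 < L i -> box L p -> has_partial (box L) i f p ->
  has_partial (box L) i g p ->
  partial (box L) i (fun q => f q - g q) p =
  partial (box L) i f p - partial (box L) i g p.
Proof.
move=> L0 Dp fp gp; have PF := increments_proper L0 Dp.
apply: cvg_lim => //.
have -> : diff_quot i (fun q => f q - g q) p =
    (fun h => diff_quot i f p h - diff_quot i g p h).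
  by apply/funext => h; rewrite /diff_quot -mulrBr; congr (_ * _); ring.
by apply: cvgB; [exact: fp|exact: gp].
Qed.

(** A line in a direction j <> i through a point of the face stays in the
    face. *)
Lemma partial_face L i j b f p : 0 < L j -> box L p -> j != i ->
  (forall q, box L q -> q 0 i = b -> f q = 0) -> p 0 i = b ->
  partial (box L) j f p = 0.
Proof.
move=> L0 Dp ji f0 pb; have PF := increments_proper L0 Dp.
apply: cvg_lim => //.
have c0 : cst 0 h @[h --> within (increments (box L) j p) (0 : R)^'] --> (0 : R).
  exact: cvg_cst.
apply: (cvg_trans _ c0).
apply: (@fmap_within_eq _ _ _ (0 : R)^') => h /set_mem hD.
rewrite /diff_quot !f0 ?subr0 ?mulr0//.
by rewrite -/(slide p j h) slideE eq_sym (negbTE ji) addr0.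
Qed.

(** The form in which identities are extended by continuity to the boundary of
    the box: q is a point towards which one moves away from the boundary. *)
Lemma segment_limit L f p q : (forall i, 0 <= L i) -> {within box L, continuous f} ->
  box L p -> (forall s, 0 < s <= 1 -> f (p + s *: (q - p)) = 0) ->
  (forall s, 0 < s <= 1 -> box L (p + s *: (q - p))) ->
  f p = 0.
Proof.
move=> L0 cf Dp f0 Ds.
pose g s := (f \o clamp L) (p + s *: (q - p)).
have cg : g s @[s --> (0:R)] --> g 0.
  apply: (continuous_comp (f := fun s => p + s *: (q - p))
    (g := f \o clamp L)).
    apply: (@cvg_rowP _ _ _ (nbhs (0:R))) => j.
    rewrite (_ : (fun x => _) = fun x : R => p 0 j + x * (q 0 j - p 0 j)).
      rewrite !mxE.
      apply: cvgD; first exact: cvg_cst.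
      by apply: cvgM; [exact: cvg_id|exact: cvg_cst].
    by apply/funext => x; rewrite !mxE.
  exact: continuous_comp_clamp.
have g0 : g 0 = f p by rewrite /g scale0r addr0 /= clamp_id.
rewrite -g0.
have gr : g s @[s --> 0^'+] --> g 0 by exact: cvg_at_right_filter.
apply: (cvg_unique _ gr) => //.
apply: cvg_near_cst.
near=> s.
have s01 : 0 < s <= 1.
  apply/andP; split; first by near: s; exact: nbhs_right_gt.
  by near: s; apply: nbhs_right_le.
by rewrite /g /= clamp_id ?f0//; exact: Ds.
Unshelve. all: by end_near. Qed.

End partial.

(** * Symmetry of second derivatives *)

Section schwarz.
Context {R : realType} {n : nat}.
Implicit Types (L : 'I_n -> R) (p q : 'rV[R]_n) (f g : 'rV[R]_n -> R)
  (D : set 'rV[R]_n) (i j : 'I_n) (s : R).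

Lemma Ck_continuous k D f : Ck k D f -> {within D, continuous f}.
Proof. by case: k => [[]|k []]. Qed.

Lemma Ck_has_partial i k D f p :
  Ck k.+1 D f -> D p -> has_partial D i f p.
Proof. by move=> [_ /(_ i)[+ _]]; exact. Qed.

Lemma Ck_partial i k D f : Ck k.+1 D f -> Ck k D (partial D i f).
Proof. by move=> [_ /(_ i)[]]. Qed.

Lemma CkW k D f : Ck k.+1 D f -> Ck k D f.
Proof.
elim: k f => [|k IH] f [cf fk]; split => // i.
by split; [exact: (fk i).1|apply: IH; exact: (fk i).2].
Qed.

Lemma Ck_line_derivative i k L f : Ck k.+1 (box L) f ->
  line_derivative L i f (partial (box L) i f).
Proof.
by move=> fk; apply: has_partial_line_derivative => p; exact: Ck_has_partial fk.
Qed.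

(** The second difference of f over a small square is the mixed derivative at
    some point of the square, by applying the mean value theorem in the two
    directions in turn.  The left-hand side is symmetric in i and j, the order
    of differentiation on the right is not: this is the source of the symmetry
    of second derivatives. *)
Lemma square_MVT L i j f fi fij p d : (forall i, 0 <= L i) -> 0 < d ->
  {within box L, continuous f} -> {within box L, continuous fi} ->
  line_derivative L i f fi -> line_derivative L j fi fij ->
  box L p -> box L (slide p i d) -> box L (slide p j d) ->
  box L (slide (slide p i d) j d) ->
  exists a b, [/\ 0 <= a <= d, 0 <= b <= d &
    f (slide (slide p i d) j d) - f (slide p i d) - f (slide p j d) + f p =
    fij (slide (slide p i a) j b) * d ^+ 2].
Proof.
move=> L0 d0 cf cfi fi_ fij_ Dp Di Dj Dij.
pose phi s := f (slide (slide p j d) i s) - f (slide p i s).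
pose dphi s := fi (slide (slide p j d) i s) - fi (slide p i s).
have Dj0 : box L (slide (slide p j d) i 0) by rewrite slide0.
have Djd : box L (slide (slide p j d) i d) by rewrite slideC.
have D0 : box L (slide p i 0) by rewrite slide0.
have [a ad phiE] : exists2 a, a \in `]0, d[ & phi d - phi 0 = dphi a * (d - 0).
  apply: MVT => //.
    move=> s sd.
    have h1 := is_derive_slide fi_ Dj0 Djd sd.
    have h2 := is_derive_slide fi_ D0 Di sd.
    exact: is_deriveB h1 h2.
  have /subspace_continuousP c1 := within_continuous_slide L0 cf Dj0 Djd.
  have /subspace_continuousP c2 := within_continuous_slide L0 cf D0 Di.
  apply/subspace_continuousP => s sd; apply: cvgB; [exact: c1|exact: c2].
have ad' : 0 <= a <= d by move: ad; rewrite in_itv /=; lra.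
have Da : box L (slide (slide p i a) j 0) by rewrite slide0; exact: box_slide D0 Di ad'.
have Dad : box L (slide (slide p i a) j d).
  by rewrite slideC; exact: box_slide Dj0 Djd ad'.
have [b bd dphiE] : exists2 b, b \in `]0, d[ &
    fi (slide (slide p i a) j d) - fi (slide (slide p i a) j 0) =
    fij (slide (slide p i a) j b) * (d - 0).
  apply: (MVT (f := fun s => fi (slide (slide p i a) j s))
    (df := fun s => fij (slide (slide p i a) j s))) => //.
    by move=> s sd; exact: is_derive_slide fij_ Da Dad sd.
  exact: within_continuous_slide.
exists a, b; split => //; first by move: bd; rewrite in_itv /=; lra.
have -> : fij (slide (slide p i a) j b) * d ^+ 2 = dphi a * (d - 0).
  rewrite /dphi -(slideC p i j) -[in X in _ - X](slide0 (slide p i a) j).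
  by rewrite dphiE subr0 expr2 mulrA.
by rewrite -phiE /phi !slide0 slideC; ring.
Qed.

(** It is enough that p is the lower left corner of small squares in the box. *)
Lemma schwarz_interior L i j f p : (forall i, 0 <= L i) -> Ck 2 (box L) f ->
  box L p -> p 0 i < L i -> p 0 j < L j -> i != j ->
  partial (box L) i (partial (box L) j f) p =
  partial (box L) j (partial (box L) i f) p.
Proof.
move=> L0 f2 Dp pi pj ij.
set u := partial _ i _; set v := partial _ j _.
have cu : {within box L, continuous u}.
  exact: Ck_continuous (Ck_partial i (Ck_partial j f2)).
have cv : {within box L, continuous v}.
  exact: Ck_continuous (Ck_partial j (Ck_partial i f2)).
have du : line_derivative L i (partial (box L) j f) u.
  exact: Ck_line_derivative (Ck_partial j f2).
have dv : line_derivative L j (partial (box L) i f) v.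
  exact: Ck_line_derivative (Ck_partial i f2).
(* from here on only the line derivatives of u and v matter *)
clearbody u v.
apply/eqP; rewrite -subr_eq0 -normr_le0; apply/ler_addgt0Pr => e e0; rewrite add0r.
have e2 : 0 < e / 2 by rewrite divr_gt0.
have near_clamp g : {within box L, continuous g} ->
    nbhs p [set x | `|g p - g (clamp L x)| < e / 2].
  move=> cg; have /cvgrPdist_lt/(_ _ e2) := @continuous_comp_clamp _ _ L g L0 cg p.
  by rewrite [(g \o clamp L) p]/= (clamp_id Dp).
have nb := @filterI _ _ (nbhs_filter p) _ _ (near_clamp u cu) (near_clamp v cv).
have [r /= r0 rP] := (nbhs_ballP _ _).1 nb.
pose d := Num.min (r / 2) (Num.min (L i - p 0 i) (L j - p 0 j)).
have d0 : 0 < d by rewrite !lt_min divr_gt0 ?subr_gt0//= pi.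
have [dr [di dj]] : d <= r / 2 /\ d <= L i - p 0 i /\ d <= L j - p 0 j.
  by rewrite /d !ge_min !lexx !orbT.
have Dab a b : 0 <= a <= d -> 0 <= b <= d -> box L (slide (slide p i a) j b).
  move=> a0 b0 k; have := Dp k; rewrite !slideE.
  case: (eqVneq k j) => [->|_]; first by rewrite eq_sym (negbTE ij); lra.
  by case: (eqVneq k i) => [->|_]; lra.
have bab a b : 0 <= a <= d -> 0 <= b <= d -> ball p r (slide (slide p i a) j b).
  move=> a0 b0; split => // k l; rewrite (ord1 k) slideE slideE /ball /=.
  case: (eqVneq l j) => [->|_].
    by rewrite eq_sym (negbTE ij) addr0 opprD addNKr normrN ger0_norm; lra.
  by rewrite addr0 opprD addNKr normrN; case: ifP => _; rewrite ger0_norm; lra.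
have z : (0 : R) <= 0 <= d by lra.
have dd : (0 : R) <= d <= d by lra.
have D0 : box L (slide p i d) by have := Dab _ _ dd z; rewrite slide0.
have D1 : box L (slide p j d) by have := Dab _ _ z dd; rewrite slide0.
have [a [b [ha hb vE]]] := square_MVT L0 d0 (Ck_continuous f2)
  (Ck_continuous (Ck_partial i f2)) 
  (Ck_line_derivative f2) dv Dp D0 D1 (Dab _ _ dd dd).
have D2 : box L (slide (slide p j d) i d) by rewrite slideC; exact: Dab.
have [b' [a' [hb' ha' uE]]] := square_MVT L0 d0 (Ck_continuous f2)
  (Ck_continuous (Ck_partial j f2)) 
  (Ck_line_derivative f2) du Dp D1 D0 D2.
have uv : u (slide (slide p i a') j b') = v (slide (slide p i a) j b).
  have d2 : d ^+ 2 != 0 by rewrite expf_eq0 /= gt_eqF.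
  apply: (mulIf d2); rewrite -vE slideC -uE (slideC p j i d d); ring.
have [+ _] := rP _ (bab _ _ ha' hb').
have [_ +] := rP _ (bab _ _ ha hb).
rewrite /= (clamp_id (Dab _ _ ha hb)) (clamp_id (Dab _ _ ha' hb')).
rewrite -uv => h1 h2.
have -> : u p - v p = (u p - u (slide (slide p i a') j b')) -
  (v p - u (slide (slide p i a') j b')) by ring.
apply: (le_trans (ler_normB _ _)); lra.
Qed.

(** The points of the segment from p to the corner 0, other than p, have all
    coordinates below their upper bounds. *)
Lemma schwarz L i j f p : (forall i, 0 < L i) -> Ck 2 (box L) f -> box L p ->
  partial (box L) i (partial (box L) j f) p =
  partial (box L) j (partial (box L) i f) p.
Proof.
move=> Lpos f2 Dp; have [->//|ij] := eqVneq i j.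
have L0 k : 0 <= L k by exact: ltW.
apply/eqP; rewrite -subr_eq0; apply/eqP.
pose w := fun p => partial (box L) i (partial (box L) j f) p -
  partial (box L) j (partial (box L) i f) p.
have Ds s k : 0 < s <= 1 -> 0 <= (p + s *: (0 - p)) 0 k < L k.
  move=> /andP[s0 s1]; rewrite !mxE; have /andP[pk0 pkL] := Dp k.
  have := Lpos k; nra.
apply: (@segment_limit _ _ L w p 0) => //.
- have /subspace_continuousP cu := Ck_continuous (Ck_partial i (Ck_partial j f2)).
  have /subspace_continuousP cv := Ck_continuous (Ck_partial j (Ck_partial i f2)).
  by apply/subspace_continuousP => q Dq; apply: cvgB; [exact: cu|exact: cv].
- move=> s s01; rewrite /w (@schwarz_interior L i j) ?subrr//.
  + by move=> k; have /andP[-> /ltW] := Ds _ k s01.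
  + by have /andP[] := Ds _ i s01.
  + by have /andP[] := Ds _ j s01.
- by move=> s s01 k; have /andP[-> /ltW] := Ds _ k s01.
Qed.

End schwarz.

(** * Measurability and integrals on products *)

Section measurability.
Context {R : realType}.

Definition grid_floor (n : nat) (r : R) : R := (Num.floor (r * n.+1%:R))%:~R / n.+1%:R.

Lemma cvg_grid_floor (r : R) : grid_floor n r @[n --> \oo] --> r.
Proof.
apply/cvgrPdist_le => e e0.
have /cvgrPdist_le /(_ _ e0) := @cvg_harmonic R.
apply: filterS => n; rewrite sub0r normrN /harmonic => hn.
apply: le_trans hn; rewrite [leRHS]gtr0_norm ?invr_gt0//.
rewrite /grid_floor -[X in `|X - _|](mulfK (_ : n.+1%:R != 0))//.
rewrite -mulrBl normrM [X in _ * X]gtr0_norm ?invr_gt0// ler_piMl ?invr_ge0//.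
have := floor_itv (r * n.+1%:R); rewrite intrD => /andP[h1 h2].
rewrite ger0_norm; lra.
Qed.

(** Caratheodory functions are measurable: the second argument is rounded down
    to the grid of mesh 1/(n+1), which makes the function piecewise constant in
    it, and the mesh tends to 0.  Applied one coordinate at a time, this gives
    the measurability of continuous functions for product sigma-algebras. *)
Lemma measurable_caratheodory d (T : measurableType d) (f : T * R -> R) :
  (forall r, measurable_fun setT (fun a => f (a, r))) ->
  (forall a, continuous (fun r => f (a, r))) -> measurable_fun setT f.
Proof.
move=> mf cf.
apply: (@measurable_fun_cvg _ _ _ _ (fun n z => f (z.1, grid_floor n z.2))).
  move=> n _ B mB; rewrite setTI.
  rewrite (_ : _ @^-1` B = \bigcup_(k : int)
    (((fun a => f (a, k%:~R / n.+1%:R)) @^-1` B) `*`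
     `[k%:~R / n.+1%:R, (k + 1)%:~R / n.+1%:R[)).
    apply: countable_bigcupT_measurable => // k.
    apply: measurableX; last exact: measurable_itv.
    by rewrite -[X in measurable X]setTI; exact: mf.
  apply/seteqP; split => [[a r] /= Bar|[a r] [k _ [/= Bk]]].
    exists (Num.floor (r * n.+1%:R)) => //; split => //=.
    rewrite in_itv /= ler_pdivrMr// ltr_pdivlMr//.
    exact: floor_itv.
  rewrite in_itv /= ler_pdivrMr// ltr_pdivlMr// => kr.
  by rewrite /grid_floor (floor_def kr).
move=> [a r] _ /=.
by apply: (@continuous_cvg nat _ _ \oo _ (grid_floor ^~ r)
  (fun r => f (a, r)) r (cf a r) (@cvg_grid_floor r)).
Qed.

End measurability.

Section product_sigma_finite.
Context d1 d2 (T1 : measurableType d1) (T2 : measurableType d2) (R : realType).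
Variable m1 : {sigma_finite_measure set T1 -> \bar R}.
Variable m2 : {sigma_finite_measure set T2 -> \bar R}.

(** A name for the product measure that carries its sigma-finiteness, so that
    Fubini's theorem applies to iterated products of measures. *)
Definition sigma_finite_prod : set (T1 * T2) -> \bar R := (m1 \x m2)%E.

Lemma sigma_finite_prodP : sigma_finite setT sigma_finite_prod.
Proof.
have /sigma_finiteP[F [FT ndF Foo]] := sigma_finiteT m1.
have /sigma_finiteP[G [GT ndG Goo]] := sigma_finiteT m2.
exists (fun n => F n `*` G n).
  apply/esym; rewrite -subTset => -[x y] _.
  have [i _ Fx] : (\bigcup_i F i) x by rewrite -FT.
  have [j _ Gy] : (\bigcup_j G j) y by rewrite -GT.
  exists (maxn i j) => //; split => /=.
    by move: x Fx; exact/subsetPset/ndF/leq_maxl.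
  by move: y Gy; exact/subsetPset/ndG/leq_maxr.
move=> n; have [mF Fn] := Foo n; have [mG Gn] := Goo n.
split; first exact: measurableX.
by rewrite /sigma_finite_prod product_measure1E// lte_mul_pinfty// ge0_fin_numE.
Qed.

HB.instance Definition _ := Measure.on sigma_finite_prod.
HB.instance Definition _ :=
  Measure_isSigmaFinite.Build _ _ _ sigma_finite_prod sigma_finite_prodP.

End product_sigma_finite.

Section integrals.
Context {R : realType}.
Local Open Scope ereal_scope.

Lemma bounded_support_integrable d (T : measurableType d)
    (m : {measure set T -> \bar R}) (g : T -> R) (C : set T) (M : R) :
  measurable_fun setT g -> measurable C -> m C < +oo ->
  (forall a, `|g a| <= M)%R -> (forall a, ~ C a -> g a = 0%R) ->
  m.-integrable setT (EFin \o g).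
Proof.
move=> mg mC Coo gM g0.
have -> : EFin \o g = (EFin \o g) \_ C.
  apply/funext => a; rewrite patchE; case: ifPn => // /negP aC.
  by rewrite /= g0// => Ca; apply: aC; exact: mem_set.
apply/(integrable_mkcond _ mC); apply: measurable_bounded_integrable => //.
  exact: measurable_funS mg.
exists M; split; first exact: num_real.
by move=> x Mx a _; apply: le_trans (gM a) (ltW Mx).
Qed.

Section fubini0.
Context d1 d2 (T1 : measurableType d1) (T2 : measurableType d2).
Variable m1 : {sigma_finite_measure set T1 -> \bar R}.
Variable m2 : {sigma_finite_measure set T2 -> \bar R}.
Variable f : T1 * T2 -> \bar R.
Hypothesis fi : (m1 \x m2).-integrable setT f.

Lemma prod_integral0r : (forall x, \int[m2]_y f (x, y) = 0) ->
  \int[m1 \x m2]_z f z = 0.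
Proof.
by move=> f0; rewrite -integral12_prod_meas1//; apply: integral0_eq => x _; exact: f0.
Qed.

Lemma prod_integral0l : (forall y, \int[m1]_x f (x, y) = 0) ->
  \int[m1 \x m2]_z f z = 0.
Proof.
by move=> f0; rewrite -integral21_prod_meas1//; apply: integral0_eq => x _; exact: f0.
Qed.

End fubini0.

Local Notation mu := (@lebesgue_measure R).


Lemma box_bounded n (L : 'I_n -> R) (f : 'rV[R]_n -> R) :
  {within box L, continuous f} -> exists M, forall p, box L p -> (`|f p| <= M)%R.
Proof.
move=> cf.
have cL : compact (box L).
  rewrite (_ : box L =
    [set v : 'rV[R]_n | forall i, `[0%R, L i]%classic (v ord0 i)]).
    apply: (@rV_compact _ _ (fun i => `[0%R, L i]%classic)) => i.
    exact: segment_compact.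
  by apply/seteqP; split => p Dp i; have := Dp i; rewrite /= in_itv.
have [M [_ fM]] := compact_bounded (continuous_compact cf cL).
exists (M + 1)%R => p Dp.
by apply: (fM (M + 1)%R); [rewrite ltrDl|exists p].
Qed.

Definition unit_itv : set R := `[0%R, 1%R].
Definition unit_cube : set (R * R * R) := (unit_itv `*` unit_itv) `*` unit_itv.

Lemma unit_itvP x : unit_itv x <-> (0 <= x <= 1)%R.
Proof. by rewrite /unit_itv /= in_itv. Qed.

Lemma measurable_unit_itv : measurable unit_itv.
Proof. exact: measurable_itv. Qed.

Lemma measurable_unit_square : measurable (unit_itv `*` unit_itv).
Proof. by apply: measurableX; exact: measurable_unit_itv. Qed.

Lemma measurable_unit_cube : measurable unit_cube.
Proof.
apply: measurableX; first exact: measurable_unit_square.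
exact: measurable_unit_itv.
Qed.

Lemma unit_itv1 : mu unit_itv = 1.
Proof. by rewrite /unit_itv lebesgue_measure_itv /= lte01 oppr0 adde0. Qed.

Lemma unit_square1 : (mu \x mu) (unit_itv `*` unit_itv) = 1.
Proof.
apply: (etrans (product_measure1E _ _ _ _)); try exact: measurable_unit_itv.
by rewrite [X in X * _]unit_itv1 [X in _ * X]unit_itv1 mule1.
Qed.

Lemma unit_cube1 : (mu \x mu \x mu) unit_cube = 1.
Proof.
apply: (etrans (product_measure1E _ _ _ _)).
- exact: measurable_unit_square.
- exact: measurable_unit_itv.
- by rewrite [X in X * _]unit_square1 [X in _ * X]unit_itv1 mule1.
Qed.

Lemma unit_square_lty : (mu \x mu) (unit_itv `*` unit_itv) < +oo.
Proof. by rewrite unit_square1 ltry. Qed.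

Lemma unit_cube_lty : (mu \x mu \x mu) unit_cube < +oo.
Proof. by rewrite unit_cube1 ltry. Qed.

Lemma unit_cube_itv_lty (a b : R) :
  (mu \x mu \x mu \x mu) (unit_cube `*` `[a, b]) < +oo.
Proof.
have E : (mu \x mu \x mu \x mu) (unit_cube `*` `[a, b]) =
    (mu \x mu \x mu) unit_cube * mu `[a, b].
  apply: (etrans (product_measure1E _ _ _ _)) => //; exact: measurable_unit_cube.
rewrite E unit_cube1 mul1e lebesgue_measure_itv /=.
by case: ifP => _; rewrite ?ltry// -EFinD ltry.
Qed.

(** * Space-time coordinates *)

Section spacetime.
Local Open Scope ring_scope.

Definition sides (T : R) (i : 'I_(1 + 3)) : R :=
  if fintype.split i is inl _ then T else 1.

Lemma sides_time T : sides T time_idx = T.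
Proof. by rewrite /sides (unsplitK (inl _)). Qed.

Lemma sides_space T w : sides T (space_idx w) = 1.
Proof. by rewrite /sides (unsplitK (inr _)). Qed.

Lemma cylinder_box T : cylinder T = box (sides T).
Proof.
apply/seteqP; split => p /=.
  move=> [pT pc] i; case: (split_ordP i) => j ->.
    by rewrite (ord1 j) -/time_idx sides_time; move: pT; rewrite mxE.
  by rewrite -/(space_idx j) sides_space; have := pc j; rewrite mxE.
move=> Dp; split; first by have := Dp time_idx; rewrite sides_time mxE.
by move=> j; have := Dp (space_idx j); rewrite sides_space mxE.
Qed.

Lemma txyz_time t x : txyz t x 0 time_idx = t :> R.
Proof. by rewrite /txyz row_mxEl mxE eqxx. Qed.

Lemma txyz_space t x w : txyz t x 0 (space_idx w) = x 0 w :> R.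
Proof. by rewrite /txyz row_mxEr. Qed.

Lemma txyz_split p : p = txyz (lsubmx p 0 0) (rsubmx p) :> 'rV[R]_(1 + 3).
Proof. by rewrite /txyz -mx11_scalar hsubmxK. Qed.

Lemma slide_time t x s : slide (txyz t x) time_idx s = txyz (t + s) x :> 'rV[R]_(1 + 3).
Proof.
apply/rowP => i; rewrite slideE; case: (split_ordP i) => j ->.
  by rewrite (ord1 j) -/time_idx !txyz_time eqxx.
by rewrite -/(space_idx j) !txyz_space eq_rlshift addr0.
Qed.

Lemma slide_space t x w s :
  slide (txyz t x) (space_idx w) s = txyz t (slide x w s) :> 'rV[R]_(1 + 3).
Proof.
apply/rowP => i; rewrite slideE; case: (split_ordP i) => j ->.
  by rewrite (ord1 j) -/time_idx !txyz_time eq_lrshift addr0.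
by rewrite -/(space_idx j) !txyz_space slideE (inj_eq (@rshift_inj _ _)).
Qed.

Lemma slide_pt3 (x y z s : R) : [/\
  slide (pt3 (x, y, z)) 0 s = pt3 (x + s, y, z),
  slide (pt3 (x, y, z)) 1 s = pt3 (x, y + s, z) &
  slide (pt3 (x, y, z)) 2 s = pt3 (x, y, z + s)].
Proof.
by split; apply/rowP => i; rewrite slideE !mxE /=;
  case: i => [[|[|[|i]]] ilt] //=; rewrite ?addr0.
Qed.

Lemma cube_pt3 (a : R * R * R) : cube (pt3 a) <-> unit_cube a.
Proof.
case: a => [[x y] z]; rewrite /unit_cube; split.
  move=> c; split; [split|]; apply/unit_itvP.
  - by have := c 0; rewrite mxE.
  - by have := c 1; rewrite mxE.
  - by have := c 2; rewrite mxE.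
move=> [[/= /unit_itvP xI /unit_itvP yI] /unit_itvP zI] i; rewrite mxE.
by case: i => [[|[|[|i]]] ilt].
Qed.

Lemma box_txyz T t a :
  box (sides T) (txyz t (pt3 a)) <-> 0 <= t <= T /\ unit_cube a.
Proof.
rewrite -cylinder_box -cube_pt3 /cylinder /=.
by rewrite /txyz row_mxKl row_mxKr mxE eqxx.
Qed.

Lemma measurable_spacetime (phi : 'rV[R]_(1 + 3) -> R) : continuous phi ->
  measurable_fun setT (fun z : (R * R * R) * R => phi (txyz z.2 (pt3 z.1))).
Proof.
move=> cphi.
have cslide (p : 'rV[R]_(1 + 3)) i : continuous (fun s => phi (slide p i s)).
  move=> s; apply: (continuous_comp (f := slide p i) (g := phi)).
    exact: continuous_slide.
  exact: cphi.
have ct a : continuous (fun t => phi (txyz t (pt3 a))).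
  rewrite (_ : (fun _ => _) = fun s => phi (slide (txyz 0 (pt3 a)) time_idx s))//.
  by apply/funext => s; rewrite slide_time add0r.
have cx t y z : continuous (fun x => phi (txyz t (pt3 (x, y, z)))).
  rewrite (_ : (fun _ => _) =
    fun s => phi (slide (txyz t (pt3 (0, y, z))) (space_idx 0) s))//.
  apply/funext => s; rewrite slide_space.
  by have [-> _ _] := slide_pt3 0 y z s; rewrite add0r.
have cy t x z : continuous (fun y => phi (txyz t (pt3 (x, y, z)))).
  rewrite (_ : (fun _ => _) =
    fun s => phi (slide (txyz t (pt3 (x, 0, z))) (space_idx 1) s))//.
  apply/funext => s; rewrite slide_space.
  by have [_ -> _] := slide_pt3 x 0 z s; rewrite add0r.
have cz t x y : continuous (fun z => phi (txyz t (pt3 (x, y, z)))).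
  rewrite (_ : (fun _ => _) =
    fun s => phi (slide (txyz t (pt3 (x, y, 0))) (space_idx 2) s))//.
  apply/funext => s; rewrite slide_space.
  by have [_ _ ->] := slide_pt3 x y 0 s; rewrite add0r.
apply: measurable_caratheodory => //= t.
apply: (@measurable_caratheodory _ _ _
  (fun a => phi (txyz t (pt3 a)))) => [z|[x y]]; last exact: cz.
apply: (@measurable_caratheodory _ _ _
  (fun a => phi (txyz t (pt3 (a, z))))) => [y|x]; last exact: cy.
by apply: continuous_measurable_fun; exact: cx.
Qed.

End spacetime.

End integrals.

(** * Densities whose time derivative is a divergence *)

Section conservation.
Context {R : realType}.
Local Notation mu := (@lebesgue_measure R).
Local Notation mu2 := (mu \x mu)%E.
Local Notation mu3 := (mu \x mu \x mu)%E.

Lemma line_integral0 n (L : 'I_n -> R) i (G g : 'rV[R]_n -> R) p :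
  (forall j, 0 <= L j) -> L i = 1 ->
  {within box L, continuous G} -> {within box L, continuous g} ->
  line_derivative L i G g ->
  (forall q, box L q -> q 0 i = 0 \/ q 0 i = 1 -> G q = 0) ->
  box L p -> p 0 i = 0 ->
  (\int[mu]_(s in unit_itv) (g (slide p i s))%:E = 0)%E.
Proof.
move=> L0 Li cG cg Gg G0 Dp pi.
have D0 : box L (slide p i 0) by rewrite slide0.
have D1 : box L (slide p i 1).
  move=> j; have := Dp j; rewrite slideE; case: eqP => [->|_]; last by rewrite addr0.
  by rewrite pi Li add0r ler01 lexx.
rewrite (line_FTC L0 cG cg Gg D0 D1)// !G0 ?sube0//.
  by left; rewrite slide0.
by right; rewrite slideE eqxx pi add0r.
Qed.

Lemma clamp_bounded n (L : 'I_n -> R) (f : 'rV[R]_n -> R) :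
  (forall i, 0 <= L i) -> {within box L, continuous f} ->
  exists M, forall p, `|(f \o clamp L) p| <= M.
Proof.
move=> L0 /box_bounded[M fM]; exists M => p; apply: fM; exact: clamp_box.
Qed.

Lemma patch_bounded (T : Type) (D : set T) (f : T -> R) M :
  (forall x, `|f x| <= M) -> forall x, `|(f \_ D) x| <= M.
Proof.
move=> fM x; rewrite patchE; case: ifP => // _; rewrite normr0.
exact: le_trans (fM x).
Qed.

Lemma patch_out (T : Type) (D : set T) (f : T -> R) x : ~ D x -> (f \_ D) x = 0.
Proof. by move=> Dx; rewrite patchE; case: ifPn => // /set_mem. Qed.

Lemma patch_in (T : Type) (D : set T) (f : T -> R) x : D x -> (f \_ D) x = f x.
Proof. by move=> Dx; rewrite patchE mem_set. Qed.

Section fixed_box.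
Variables (T : R).
Hypothesis T0 : 0 < T.
Let L := sides T.

Let L0 i : 0 <= L i.
Proof. by rewrite /L /sides; case: fintype.split => _; rewrite ?ler01 ?ltW. Qed.

(** The time slice of f at t, extended by 0 outside the cube.  Through the
    projection onto the cylinder it does not depend on values of f outside of
    the cylinder, so that it is measurable and bounded. *)
Definition cut (f : 'rV[R]_(1 + 3) -> R) (t : R) : R * R * R -> R :=
  (fun a => (f \o clamp L) (txyz t (pt3 a))) \_ unit_cube.

Lemma cut_in f t a : 0 <= t <= T -> unit_cube a -> cut f t a = f (txyz t (pt3 a)).
Proof. by move=> tT aC; rewrite /cut patch_in//= clamp_id//; exact/box_txyz. Qed.

Lemma measurable_cut f t : {within box L, continuous f} ->
  measurable_fun setT (cut f t).
Proof.
move=> cf; apply/(measurable_restrictT _ measurable_unit_cube).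
apply: measurable_funS (measurableT) (@subsetT _ _) _.
have mf := measurable_spacetime (continuous_comp_clamp L0 cf).
exact: (measurable_fun_pair1 t mf).
Qed.

Lemma cut_integrable f t : {within box L, continuous f} ->
  mu3.-integrable setT (EFin \o cut f t).
Proof.
move=> cf; have [M fM] := clamp_bounded L0 cf.
apply: (@bounded_support_integrable _ _ _ mu3 (cut f t) unit_cube M).
- exact: measurable_cut.
- exact: measurable_unit_cube.
- exact: unit_cube_lty.
- by apply: patch_bounded => a; exact: fM.
- by move=> a; exact: patch_out.
Qed.

Lemma cut_slice_integrable f t z : {within box L, continuous f} ->
  mu2.-integrable setT (fun b => (cut f t (b, z))%:E).
Proof.
move=> cf; have [M fM] := clamp_bounded L0 cf.
apply: (@bounded_support_integrable _ _ _ mu2 (fun b => cut f t (b, z))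
  (unit_itv `*` unit_itv) M).
- exact: (measurable_fun_pair1 z (measurable_cut t cf)).
- exact: measurable_unit_square.
- exact: unit_square_lty.
- by move=> a; apply: patch_bounded => b; exact: fM.
- by move=> a aC; apply: patch_out => -[].
Qed.

Lemma cut_integral f t : 0 <= t <= T ->
  (\int[mu3]_a (cut f t a)%:E =
   \int[mu3]_(a in unit_cube) (f (txyz t (pt3 a)))%:E)%E.
Proof.
move=> tT; rewrite [RHS]integral_mkcond; apply: eq_integral => a _.
rewrite patchE; case: ifPn => [/set_mem aC|/negP aC].
  by rewrite cut_in.
by rewrite /cut patch_out// => aC'; apply: aC; exact: mem_set.
Qed.

(** Fubini's theorem lets the direction w be integrated first; on each line in
    this direction the fundamental theorem of calculus gives the difference of
    two values of G on faces. *)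
Lemma cut_divergence0 G g t w : 0 <= t <= T ->
  {within box L, continuous G} -> {within box L, continuous g} ->
  line_derivative L (space_idx w) G g ->
  (forall q, box L q -> q 0 (space_idx w) = 0 \/ q 0 (space_idx w) = 1 -> G q = 0) ->
  (\int[mu3]_a (cut g t a)%:E = 0)%E.
Proof.
move=> tT cG cg Gg G0.
have line (k : R -> R) (a : R * R * R) : pt3 a 0 w = 0 ->
    (unit_cube a -> forall s, unit_itv s ->
      k s = g (slide (txyz t (pt3 a)) (space_idx w) s)) ->
    (forall s, ~ (unit_itv s /\ unit_cube a) -> k s = 0) ->
    (\int[mu]_s (k s)%:E = 0)%E.
  move=> aw kin kout; have [aC|aC] := pselect (unit_cube a); last first.
    by apply: integral0_eq => s _; rewrite kout// => -[].
  have Da : box L (txyz t (pt3 a)) by apply/box_txyz.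
  have aw' : txyz t (pt3 a) 0 (space_idx w) = 0 by rewrite txyz_space.
  rewrite -(line_integral0 L0 (sides_space T w) cG cg Gg G0 Da aw').
  rewrite [RHS]integral_mkcond; apply: eq_integral => s _.
  rewrite patchE; case: ifPn => [/set_mem sI|/negP sI]; first by rewrite kin.
  by rewrite kout// => -[sI' _]; apply: sI; exact: mem_set.
have I0 : unit_itv (0 : R) by apply/unit_itvP; rewrite lexx ler01.
case: w {Gg G0} line => -[|[|[|w]]] wlt // line.
- apply: (@prod_integral0l _ _ _ _ _ (sigma_finite_prod mu mu) mu
    (fun a => (cut g t a)%:E) (cut_integrable t cg)) => z.
  apply: (@prod_integral0l _ _ _ _ _ mu mu
    (fun b => (cut g t (b, z))%:E) (cut_slice_integrable t z cg)) => y.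
  apply: (line (fun x => cut g t (x, y, z)) (0, y, z)).
  + by rewrite mxE.
  + move=> [[_ yI] zI] s sI; rewrite cut_in// slide_space.
    have -> : Ordinal wlt = 0 by apply/val_inj.
    by have [-> _ _] := slide_pt3 0 y z s; rewrite add0r.
  + by move=> s sC; apply: patch_out => -[[/= sI yI] zI]; apply: sC.
- apply: (@prod_integral0l _ _ _ _ _ (sigma_finite_prod mu mu) mu
    (fun a => (cut g t a)%:E) (cut_integrable t cg)) => z.
  apply: (@prod_integral0r _ _ _ _ _ mu mu
    (fun b => (cut g t (b, z))%:E) (cut_slice_integrable t z cg)) => x.
  apply: (line (fun y => cut g t (x, y, z)) (x, 0, z)).
  + by rewrite mxE.
  + move=> [[xI _] zI] s sI; rewrite cut_in// slide_space.
    have -> : Ordinal wlt = 1 by apply/val_inj.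
    by have [_ -> _] := slide_pt3 x 0 z s; rewrite add0r.
  + by move=> s sC; apply: patch_out => -[[/= xI sI] zI]; apply: sC.
- apply: (@prod_integral0r _ _ _ _ _ (sigma_finite_prod mu mu) mu
    (fun a => (cut g t a)%:E) (cut_integrable t cg)) => -[x y].
  apply: (line (fun z => cut g t (x, y, z)) (x, y, 0)).
  + by rewrite mxE.
  + move=> [[xI yI] _] s sI; rewrite cut_in// slide_space.
    have -> : Ordinal wlt = 2 by apply/val_inj.
    by have [_ _ ->] := slide_pt3 x y 0 s; rewrite add0r.
  + by move=> s sC; apply: patch_out => -[[/= xI yI] sI]; apply: sC.
Qed.


Lemma cut_sum (g : 'I_3 -> 'rV[R]_(1 + 3) -> R) t a :
  cut (fun p => \sum_m g m p) t a = \sum_m cut (g m) t a.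
Proof.
rewrite /cut patchE; case: ifPn => [aC|aC].
  by apply: eq_bigr => m _; rewrite patchE aC.
by rewrite big1// => m _; rewrite patchE (negbTE aC).
Qed.

(** The divergence is integrated over the cube times [0, t] in both orders.
    Integrating over the cube first gives 0, and integrating over time first
    gives the increment of e at each point. *)
Lemma conservation_law e (G g : 'I_3 -> 'rV[R]_(1 + 3) -> R) :
  {within box L, continuous e} ->
  (forall w, {within box L, continuous (G w)}) ->
  (forall w, {within box L, continuous (g w)}) ->
  line_derivative L time_idx e (fun p => \sum_w g w p) ->
  (forall w, line_derivative L (space_idx w) (G w) (g w)) ->
  (forall w q, box L q -> q 0 (space_idx w) = 0 \/ q 0 (space_idx w) = 1 ->
    G w q = 0) ->
  exists c : R, forall t, 0 <= t <= T ->
    (\int[mu3]_(a in unit_cube) (e (txyz t (pt3 a)))%:E = c%:E)%E.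
Proof.
move=> ce cG cg e_g G_g G0.
set S := (fun p => \sum_w g w p) in e_g *.
have cS : {within box L, continuous S}.
  apply/subspace_continuousP => q Dq.
  have cgq w := (@subspace_continuousP _ (box L) _ (g w)).1 (cg w) q Dq.
  by apply: cvg_big => [|w _]; [exact: add_continuous|exact: cgq].
exists (fine (\int[mu3]_a (cut e 0 a)%:E)%E) => t tT.
have fin s : (\int[mu3]_a (cut e s a)%:E)%E \is a fin_num.
  exact: (integrable_fin_num measurableT (cut_integrable s ce)).
rewrite fineK// -cut_integral//.
have [->//|tN0] := eqVneq t 0.
have t0 : 0 < t by rewrite lt_neqAle eq_sym tN0; case/andP: tT.
have [M SM] := clamp_bounded L0 cS.
pose K := (fun z : (R * R * R) * R => (S \o clamp L) (txyz z.2 (pt3 z.1)))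
  \_ (unit_cube `*` `[0, t]).
have Kin a s : unit_cube a -> 0 <= s <= t -> K (a, s) = S (txyz s (pt3 a)).
  move=> aC st; rewrite /K patch_in/= ?in_itv//= clamp_id//.
  by apply/box_txyz; split => //; lra.
have Kout a s : ~ (unit_cube a /\ 0 <= s <= t) -> K (a, s) = 0.
  by move=> nas; apply: patch_out => -[/= aC st]; apply: nas; move: st; rewrite in_itv.
have mCt : measurable (unit_cube `*` `[0, t] : set ((R * R * R) * R)).
  by apply: measurableX; [exact: measurable_unit_cube|exact: measurable_itv].
have Ki : (mu3 \x mu)%E.-integrable setT (EFin \o K).
  apply: (@bounded_support_integrable _ _ _ (mu3 \x mu)%E K
    (unit_cube `*` `[0, t]) M) => //.
  - apply/(measurable_restrictT _ mCt).
    apply: measurable_funS (measurableT) (@subsetT _ _) _.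
    exact: (measurable_spacetime (continuous_comp_clamp L0 cS)).
  - exact: unit_cube_itv_lty.
  - by apply: patch_bounded => z; exact: SM.
  - by move=> z; exact: patch_out.
have K0 : (\int[mu3 \x mu]_z (K z)%:E = 0)%E.
  apply: (@prod_integral0l _ _ _ _ _ (sigma_finite_prod (sigma_finite_prod mu mu) mu) mu
     (fun z => (K z)%:E) Ki) => s.
  have [st|st] := boolP (0 <= s <= t); last first.
    by apply: integral0_eq => a _; rewrite Kout// => -[_ st']; rewrite st' in st.
  have sT : 0 <= s <= T by lra.
  transitivity (\int[mu3]_a (\sum_w (cut (g w) s a)%:E))%E.
    apply: eq_integral => a _; rewrite sumEFin -cut_sum.
    have [aC|aC] := pselect (unit_cube a); first by rewrite Kin// cut_in.
    by rewrite Kout ?/cut ?patch_out// => -[].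
  rewrite integral_sum//; last by move=> w; exact: cut_integrable.
  by apply: big1 => w _; exact: cut_divergence0 (cG w) (cg w) (G_g w) (G0 w).
have inner a : (\int[mu]_s (K (a, s))%:E = (cut e t a)%:E - (cut e 0 a)%:E)%E.
  have [aC|aC] := pselect (unit_cube a); last first.
    rewrite /cut !patch_out// subee//.
    by apply: integral0_eq => s _; rewrite Kout// => -[].
  have D0 : box L (slide (txyz 0 (pt3 a)) time_idx 0).
    by rewrite slide0; apply/box_txyz; split => //; lra.
  have Dt : box L (slide (txyz 0 (pt3 a)) time_idx t).
    by rewrite slide_time add0r; apply/box_txyz.
  have := line_FTC L0 ce cS e_g D0 Dt t0.
  rewrite slide0 slide_time add0r !cut_in//; last by lra.
  move=> <-; rewrite [RHS]integral_mkcond; apply: eq_integral => s _.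
  rewrite patchE; case: ifPn => [/set_mem|/negP] st.
    by rewrite slide_time add0r Kin//; move: st; rewrite /= in_itv.
  by rewrite Kout// => -[_ st']; apply: st; apply/mem_set; rewrite /= in_itv.
have F : (\int[mu3]_a ((cut e t a)%:E - (cut e 0 a)%:E) = 0)%E.
  rewrite -[RHS]K0.
  rewrite -(@integral12_prod_meas1 _ _ _ _ _
    (sigma_finite_prod (sigma_finite_prod mu mu) mu) mu (fun z => (K z)%:E) Ki).
  by apply: eq_integral => a _; exact/esym/inner.
move: F.
rewrite (integralB_EFin measurableT (cut_integrable t ce) (cut_integrable 0 ce)).
rewrite -(fineK (fin t)) -(fineK (fin 0)) -EFinB => -[] /eqP.
by rewrite subr_eq0 => /eqP ->.
Qed.

End fixed_box.

End conservation.

(** * Vector algebra in three dimensions *)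

Lemma ord3_addE (i : 'I_3) :
  [/\ i + 1 + 1 = i + 2, i + 1 + 2 = i, i + 2 + 1 = i & i + 2 + 2 = i + 1].
Proof. by split; apply/val_inj; case: i => [[|[|[|]]]]. Qed.

Lemma ord3_add_neq (i : 'I_3) : (i + 1 != i) /\ (i + 2 != i).
Proof. by case: i => [[|[|[|]]]]. Qed.

Lemma ord3_neqP (i j : 'I_3) : j != i -> j = i + 1 \/ j = i + 2.
Proof.
case: i j => [[|[|[|i]]] ilt] [[|[|[|j]]] jlt] //= _;
  solve [by left; apply/val_inj | by right; apply/val_inj].
Qed.

Lemma sum_ord3 (V : nmodType) (F : 'I_3 -> V) :
  \sum_i F i = F 0 + F 1 + F 2.
Proof.
rewrite !big_ord_recr big_ord0 /= add0r.
by congr (F _ + F _ + F _); apply/val_inj.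
Qed.

Section convex.
Context {R : realType}.
Implicit Types (a b s y z : R).

Lemma convex_gt a y z s : 0 < s -> s <= 1 -> a <= y -> a < z -> a < y + s * (z - y).
Proof.
move=> s0 s1 ay az.
have h1 : 0 <= (1 - s) * (y - a) by apply: mulr_ge0; lra.
have h2 : 0 < s * (z - a) by apply: mulr_gt0; lra.
by lra.
Qed.

Lemma convex_le b y z s : 0 < s -> s <= 1 -> y <= b -> z <= b -> y + s * (z - y) <= b.
Proof.
move=> s0 s1 yb zb.
have h1 : 0 <= (1 - s) * (b - y) by apply: mulr_ge0; lra.
have h2 : 0 <= s * (b - z) by apply: mulr_ge0; lra.
by lra.
Qed.

Lemma convex_lt b y z s : 0 < s -> s <= 1 -> y <= b -> z < b -> y + s * (z - y) < b.
Proof.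
move=> s0 s1 yb zb.
have h1 : 0 <= (1 - s) * (b - y) by apply: mulr_ge0; lra.
have h2 : 0 < s * (b - z) by apply: mulr_gt0; lra.
by lra.
Qed.

End convex.

Section algebra.
Context {R : realType}.
Implicit Types (v : 'rV[R]_3).

Lemma enorm_sqr v : enorm v ^+ 2 = \sum_i v 0 i * v 0 i.
Proof.
rewrite /enorm sqr_sqrtr; last by apply: sumr_ge0 => i _; exact: sqr_ge0.
by apply: eq_bigr => i _; rewrite expr2.
Qed.

Lemma outward_normalE i b j :
  outward_normal R i b 0 j = if j == i then (if b then 1 else -1) else 0.
Proof.
by rewrite !mxE eqxx /=; case: eqP => _; rewrite ?mulr1 ?mulr0.
Qed.

Lemma crossp_normal_eq0 i b v : crossp (outward_normal R i b) v = 0 ->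
  forall j, j != i -> v 0 j = 0.
Proof.
have [i11 i12 i21 i22] := ord3_addE i; have [i1 i2] := ord3_add_neq i.
move=> /rowP vi j /ord3_neqP[]->.
  have := vi (i + 2); rewrite mxE i21 i22 [RHS]mxE !outward_normalE eqxx (negbTE i1).
  by case: b {vi} => ?; lra.
have := vi (i + 1); rewrite mxE i11 i12 [RHS]mxE !outward_normalE eqxx (negbTE i2).
by case: b {vi} => ?; lra.
Qed.

Lemma dotp_normal_eq0 i b v : dotp (outward_normal R i b) v = 0 -> v 0 i = 0.
Proof.
rewrite /dotp (bigD1 i)//= outward_normalE eqxx big1 ?addr0.
  by case: b => ?; lra.
by move=> j ji; rewrite outward_normalE (negbTE ji) mul0r.
Qed.

End algebra.

(** E . curl H - H . curl E = - div (E x H), for arrays of numbers standing for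
    the fields and their first derivatives.  The two sides are matched by the
    cyclic shifts of the index. *)
Lemma poynting_identity (R : comPzRingType) (eps mu : R) (a b a' b' : 'I_3 -> R)
    (da db : 'I_3 -> 'I_3 -> R) :
  (forall k, eps * a' k = db (k + 1) (k + 2) - db (k + 2) (k + 1)) ->
  (forall k, mu * b' k = da (k + 2) (k + 1) - da (k + 1) (k + 2)) ->
  eps * (\sum_k (a k * a' k + a k * a' k)) + mu * (\sum_k (b k * b' k + b k * b' k)) =
  \sum_m 2 * ((a (m + 2) * db m (m + 1) + b (m + 1) * da m (m + 2)) -
              (a (m + 1) * db m (m + 2) + b (m + 2) * da m (m + 1))).
Proof.
move=> aE bE.
have -> : eps * (\sum_k (a k * a' k + a k * a' k)) +
    mu * (\sum_k (b k * b' k + b k * b' k)) =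
    \sum_k 2 * (a k * (eps * a' k) + b k * (mu * b' k)).
  by rewrite !mulr_sumr -big_split /=; apply: eq_bigr => k _; ring.
under eq_bigr do rewrite aE bE.
have e12 : 1 + 2 = 0 :> 'I_3 by apply/val_inj.
have e21 : 2 + 1 = 0 :> 'I_3 by apply/val_inj.
have e22 : 2 + 2 = 1 :> 'I_3 by apply/val_inj.
have e11 : 1 + 1 = 2 :> 'I_3 by apply/val_inj.
rewrite !sum_ord3 (add0r (1 : 'I_3)) (add0r (2 : 'I_3)) e12 e21 e22 e11.
ring.
Qed.



(** * The Maxwell system in the cylinder *)

Section maxwell.
Context {R : realType}.
Variables (T : R).
Hypothesis T0 : 0 < T.
Let L := sides T.

Lemma sides_gt0 i : 0 < L i.
Proof. by rewrite /L /sides; case: fintype.split. Qed.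

Let L0 i : 0 <= L i. Proof. exact/ltW/sides_gt0. Qed.

(** Each scalar component of Maxwell's equations has this form, which is stable
    under differentiation in any direction d. *)
Lemma partial_curl_eq (c : R) (e a b d : 'I_(1 + 3)) (u v v' : 'rV[R]_(1 + 3) -> R) :
  Ck 2 (box L) u -> Ck 2 (box L) v -> Ck 2 (box L) v' ->
  (forall p, box L p ->
    c * partial (box L) e u p = partial (box L) a v p - partial (box L) b v' p) ->
  forall p, box L p ->
    c * partial (box L) e (partial (box L) d u) p =
    partial (box L) a (partial (box L) d v) p -
    partial (box L) b (partial (box L) d v') p.
Proof.
move=> u2 v2 v2' uv p Dp.
have hp i f : Ck 2 (box L) f -> has_partial (box L) d (partial (box L) i f) p.
  by move=> f2; exact: Ck_has_partial (Ck_partial i f2) Dp.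
rewrite (schwarz e d sides_gt0 u2 Dp) (schwarz a d sides_gt0 v2 Dp).
rewrite (schwarz b d sides_gt0 v2' Dp).
rewrite -(partialZ c (sides_gt0 d) Dp (hp e u u2)).
rewrite -(partialB (sides_gt0 d) Dp (hp a v v2) (hp b v' v2')).
exact: eq_partial.
Qed.

Lemma segmentE (p q : 'rV[R]_(1 + 3)) s k :
  (p + s *: (q - p)) 0 k = p 0 k + s * (q 0 k - p 0 k).
Proof. by rewrite !mxE. Qed.

(** A point of a closed face at a time t >= 0 is reached along a segment that
    comes from the centre of the face at time T. *)
Lemma face_limit (f : 'rV[R]_(1 + 3) -> R) (i : 'I_3) (b : R) :
  {within box L, continuous f} -> b = 0 \/ b = 1 ->
  (forall (t : R) (x : 'rV[R]_3), 0 < t <= T -> x 0 i = b ->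
    (forall j, j != i -> 0 < x 0 j < 1) ->
    f (txyz t x) = 0) ->
  forall p, box L p -> p 0 (space_idx i) = b -> f p = 0.
Proof.
move=> cf b01 f0 p Dp pb.
pose q : 'rV[R]_(1 + 3) := txyz T (\row_j if j == i then b else 2^-1).
have Dt := Dp time_idx; rewrite /L sides_time in Dt.
have Dx j := Dp (space_idx j).
have time s : (p + s *: (q - p)) 0 time_idx =
    p 0 time_idx + s * (T - p 0 time_idx).
  by rewrite segmentE txyz_time.
have space s j : (p + s *: (q - p)) 0 (space_idx j) =
    p 0 (space_idx j) + s * ((if j == i then b else 2^-1) - p 0 (space_idx j)).
  by rewrite segmentE txyz_space mxE.
have tI s : 0 < s <= 1 -> 0 < (p + s *: (q - p)) 0 time_idx <= T.
  move=> s01; have [/andP[y0 yT] /andP[s0 s1]] := (Dt, s01).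
  by rewrite time convex_gt//= convex_le.
have xb s : (p + s *: (q - p)) 0 (space_idx i) = b.
  by rewrite space eqxx pb subrr mulr0 addr0.
have xI s j : j != i -> 0 < s <= 1 -> 0 < (p + s *: (q - p)) 0 (space_idx j) < 1.
  move=> ji /andP[s0 s1]; rewrite space (negbTE ji).
  have := Dx j; rewrite /L sides_space => /andP[x0 x1].
  by rewrite convex_gt ?convex_lt ?invr_gt0 ?invf_lt1 ?ltr1n.
apply: (segment_limit L0 cf Dp (q := q)) => s s01.
  rewrite [_ + _]txyz_split; apply: f0.
  - by rewrite [lsubmx _ _ _]mxE; exact: tI.
  - by rewrite [rsubmx _ _ _]mxE; exact: xb.
  - by move=> j ji; rewrite [rsubmx _ _ _]mxE; exact: xI.
move=> k; case: (split_ordP k) => j ->.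
  by rewrite (ord1 j) -/time_idx /L sides_time; have := tI s s01; lra.
rewrite -/(space_idx j) /L sides_space.
have [->|ji] := eqVneq j i; last by have := xI s j ji s01; lra.
by rewrite xb; case: b01 => ->; lra.
Qed.

Lemma initial_limit (f : 'rV[R]_(1 + 3) -> R) : {within box L, continuous f} ->
  (forall (t : R) (x : 'rV[R]_3), 0 < t <= T -> cube x -> f (txyz t x) = 0) ->
  forall p, box L p -> f p = 0.
Proof.
move=> cf f0 p Dp.
have Dt := Dp time_idx; rewrite /L sides_time in Dt.
pose q : 'rV[R]_(1 + 3) := txyz T (rsubmx p).
have time s : (p + s *: (q - p)) 0 time_idx =
    p 0 time_idx + s * (T - p 0 time_idx).
  by rewrite segmentE txyz_time.
have space s j : (p + s *: (q - p)) 0 (space_idx j) = p 0 (space_idx j).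
  by rewrite segmentE txyz_space [rsubmx _ _ _]mxE subrr mulr0 addr0.
have tI s : 0 < s <= 1 -> 0 < (p + s *: (q - p)) 0 time_idx <= T.
  move=> s01; have [/andP[y0 yT] /andP[s0 s1]] := (Dt, s01).
  by rewrite time convex_gt//= convex_le.
apply: (segment_limit L0 cf Dp (q := q)) => s s01.
  rewrite [_ + _]txyz_split; apply: f0.
  - by rewrite [lsubmx _ _ _]mxE; exact: tI.
  - move=> j; rewrite [rsubmx _ _ _]mxE -/(space_idx j) space.
    by have := Dp (space_idx j); rewrite /L sides_space.
move=> k; case: (split_ordP k) => j ->.
  by rewrite (ord1 j) -/time_idx /L sides_time; have := tI s s01; lra.
by rewrite -/(space_idx j) space; exact: Dp.
Qed.


Section fields.
Variables (eps mu : R) (E H : 'rV[R]_(1 + 3) -> 'rV[R]_3).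
Hypotheses (E_C3 : vCk 3 (box L) E) (H_C3 : vCk 3 (box L) H).
Hypotheses (EH_maxwell : maxwell T eps mu E H) (EH_pec : pec T E H).
Variable w : 'I_3.

Let Ej (j : 'I_3) := fun q => E q 0 j.
Let Hj (j : 'I_3) := fun q => H q 0 j.
Let dt := partial (box L) time_idx.
Let ds i := partial (box L) (space_idx i).
Let A j := ds w (dt (Ej j)).
Let B j := ds w (dt (Hj j)).

Let E2 j : Ck 2 (box L) (Ej j). Proof. exact/CkW/E_C3. Qed.
Let H2 j : Ck 2 (box L) (Hj j). Proof. exact/CkW/H_C3. Qed.
Let Et2 j : Ck 2 (box L) (dt (Ej j)). Proof. exact/Ck_partial/E_C3. Qed.
Let Ht2 j : Ck 2 (box L) (dt (Hj j)). Proof. exact/Ck_partial/H_C3. Qed.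
Let A1 j : Ck 1 (box L) (A j). Proof. exact/Ck_partial/Et2. Qed.
Let B1 j : Ck 1 (box L) (B j). Proof. exact/Ck_partial/Ht2. Qed.

Let cont1 i k f : Ck k.+1 (box L) f -> {within box L, continuous (partial (box L) i f)}.
Proof. by move=> fk; exact: Ck_continuous (Ck_partial i fk). Qed.

Lemma ampere k p : box L p -> eps * dt (Ej k) p =
  ds (k + 1) (Hj (k + 2)) p - ds (k + 2) (Hj (k + 1)) p.
Proof.
move=> Dp; apply/eqP; rewrite -subr_eq0; apply/eqP; move: p Dp.
apply: initial_limit.
  apply: within_continuousB; first exact/within_continuousZ/cont1/E2.
  by apply: within_continuousB; exact/cont1/H2.
move=> t x tT xc; have [+ _] := EH_maxwell tT xc.
by rewrite cylinder_box => /rowP/(_ k); rewrite !mxE => ->; rewrite subrr.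
Qed.

Lemma faraday k p : box L p -> mu * dt (Hj k) p =
  ds (k + 2) (Ej (k + 1)) p - ds (k + 1) (Ej (k + 2)) p.
Proof.
move=> Dp; apply/eqP; rewrite -subr_eq0; apply/eqP; move: p Dp.
apply: initial_limit.
  apply: within_continuousB; first exact/within_continuousZ/cont1/H2.
  by apply: within_continuousB; exact/cont1/E2.
move=> t x tT xc; have [_ +] := EH_maxwell tT xc.
by rewrite cylinder_box => /rowP/(_ k); rewrite !mxE => ->; rewrite opprB subrr.
Qed.

Lemma tangential_E i j b p : b = 0 \/ b = 1 -> j != i ->
  box L p -> p 0 (space_idx i) = b -> Ej j p = 0.
Proof.
move=> b01 ji Dp pb; apply: (@face_limit _ i b) pb => //.
  exact/Ck_continuous/E2.
move=> t x tT xb xI.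
have xF : open_face i (b == 1) x.
  split => //; rewrite xb; case: b01 => ->; rewrite ?eqxx//.
  by rewrite eq_sym oner_eq0.
by have [/crossp_normal_eq0/(_ j ji)] := EH_pec tT xF.
Qed.

Lemma normal_H i b p : b = 0 \/ b = 1 ->
  box L p -> p 0 (space_idx i) = b -> Hj i p = 0.
Proof.
move=> b01 Dp pb; apply: (@face_limit _ i b) pb => //.
  exact/Ck_continuous/H2.
move=> t x tT xb xI.
have xF : open_face i (b == 1) x.
  split => //; rewrite xb; case: b01 => ->; rewrite ?eqxx//.
  by rewrite eq_sym oner_eq0.
by have [_ /dotp_normal_eq0] := EH_pec tT xF.
Qed.

Lemma space_neq i j : j != i -> space_idx j != space_idx i.
Proof. by rewrite /space_idx (inj_eq (@rshift_inj _ _)). Qed.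

Lemma time_neq i : time_idx != space_idx i.
Proof. by rewrite /time_idx /space_idx eq_lrshift. Qed.

Lemma tangential_Et i j b p : b = 0 \/ b = 1 -> j != i ->
  box L p -> p 0 (space_idx i) = b -> dt (Ej j) p = 0.
Proof.
move=> b01 ji Dp pb.
apply: (partial_face (sides_gt0 _) Dp (time_neq i) _ pb) => q.
exact: tangential_E.
Qed.

(** Here d_t and d_w both differentiate along the face. *)
Lemma tangential_A i j b p : b = 0 \/ b = 1 -> w != i -> j != i ->
  box L p -> p 0 (space_idx i) = b -> A j p = 0.
Proof.
move=> b01 wi ji Dp pb.
apply: (partial_face (sides_gt0 _) Dp (space_neq wi) _ pb) => q.
exact: tangential_Et.
Qed.

(** The case in which d_w is the normal derivative.  After exchanging the
    derivatives, it suffices that d_w of the tangential components of H vanish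
    on the face, at all times; Ampere's law for a tangential component of E
    gives them, since its two other terms are tangential derivatives of
    quantities that vanish on the face. *)
Lemma tangential_B j b p : b = 0 \/ b = 1 -> j != w ->
  box L p -> p 0 (space_idx w) = b -> B j p = 0.
Proof.
move=> b01 jw Dp pb; rewrite /B /ds /dt (schwarz _ _ sides_gt0 (H2 j) Dp).
apply: (partial_face (sides_gt0 _) Dp (time_neq w) _ pb) => q Dq qb.
have [i11 i12 i21 i22] := ord3_addE w.
have [w1 w2] := ord3_add_neq w.
have Hw i : i != w -> ds i (Hj w) q = 0.
  move=> iw; apply: (partial_face (sides_gt0 _) Dq (space_neq iw) _ qb) => r.
  exact: normal_H.
case: (ord3_neqP jw) => ->.
- have := ampere (w + 2) Dq.
  by rewrite i21 i22 Hw// subr0 (tangential_Et b01 w2 Dq qb) mulr0.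
- have := ampere (w + 1) Dq.
  rewrite i11 i12 Hw// sub0r (tangential_Et b01 w1 Dq qb) mulr0 => /eqP.
  by rewrite eq_sym oppr_eq0 => /eqP.
Qed.

Lemma ampere_wt k p : box L p -> eps * dt (A k) p =
  ds (k + 1) (B (k + 2)) p - ds (k + 2) (B (k + 1)) p.
Proof.
apply: partial_curl_eq => //; apply: partial_curl_eq => //; exact: ampere.
Qed.

Lemma faraday_wt k p : box L p -> mu * dt (B k) p =
  ds (k + 2) (A (k + 1)) p - ds (k + 1) (A (k + 2)) p.
Proof.
apply: partial_curl_eq => //; apply: partial_curl_eq => //; exact: faraday.
Qed.

Definition density p : R := eps * (\sum_j A j p * A j p) + mu * (\sum_j B j p * B j p).

(** The component m of - 2 A x B, and its derivative in the direction m. *)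
Definition flux m p : R := 2 * (A (m + 2) p * B (m + 1) p - A (m + 1) p * B (m + 2) p).

Definition dflux m p : R := 2 *
  ((A (m + 2) p * ds m (B (m + 1)) p + B (m + 1) p * ds m (A (m + 2)) p) -
   (A (m + 1) p * ds m (B (m + 2)) p + B (m + 2) p * ds m (A (m + 1)) p)).

Lemma mixed_partialE (F : 'rV[R]_(1 + 3) -> 'rV[R]_3) j p :
  vpartial (box L) (space_idx w) (vpartial (box L) time_idx F) p 0 j =
  ds w (dt (fun q => F q 0 j)) p.
Proof.
rewrite mxE; congr (partial _ _ _ p).
by apply/funext => q; rewrite mxE.
Qed.

Lemma enorm_mixed_partial (F : 'rV[R]_(1 + 3) -> 'rV[R]_3) p :
  enorm (vpartial (box L) (space_idx w) (vpartial (box L) time_idx F) p) ^+ 2 =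
  \sum_j ds w (dt (fun q => F q 0 j)) p * ds w (dt (fun q => F q 0 j)) p.
Proof. by rewrite enorm_sqr; apply: eq_bigr => j _; rewrite mixed_partialE. Qed.

Lemma densityE p :
  eps * enorm (vpartial (box L) (space_idx w)
    (vpartial (box L) time_idx E) p) ^+ 2 +
  mu * enorm (vpartial (box L) (space_idx w)
    (vpartial (box L) time_idx H) p) ^+ 2 = density p.
Proof.
by congr (_ * _ + _ * _); exact: enorm_mixed_partial.
Qed.

Let cA j : {within box L, continuous (A j)}. Proof. exact/Ck_continuous/A1. Qed.
Let cB j : {within box L, continuous (B j)}. Proof. exact/Ck_continuous/B1. Qed.

Lemma flux_line_derivative m : line_derivative L (space_idx m) (flux m) (dflux m).
Proof.
have lA j : line_derivative L (space_idx m) (A j) (ds m (A j)).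
  exact: Ck_line_derivative.
have lB j : line_derivative L (space_idx m) (B j) (ds m (B j)).
  exact: Ck_line_derivative.
apply: line_derivativeZ; apply: line_derivativeB; exact: line_derivativeM.
Qed.

Lemma poynting : line_derivative L time_idx density (fun p => \sum_m dflux m p).
Proof.
have lA j : line_derivative L time_idx (A j) (dt (A j)).
  exact: Ck_line_derivative.
have lB j : line_derivative L time_idx (B j) (dt (B j)).
  exact: Ck_line_derivative.
have lAA j := line_derivativeM (lA j) (lA j).
have lBB j := line_derivativeM (lB j) (lB j).
have := line_derivativeD (line_derivativeZ eps (line_derivative_sum lAA))
  (line_derivativeZ mu (line_derivative_sum lBB)).
apply: eq_line_derivative => p Dp.
exact: (@poynting_identity R eps mu (A ^~ p) (B ^~ p)
  (fun k => dt (A k) p) (fun k => dt (B k) p)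
  (fun m k => ds m (A k) p) (fun m k => ds m (B k) p)
  (fun k => ampere_wt k Dp) (fun k => faraday_wt k Dp)).
Qed.

Lemma energy_constant : exists c : R,
  forall t : R, 0 <= t <= T -> energy_wt T eps mu E H w t = c%:E.
Proof.
have [c ec] : exists c : R, forall t, 0 <= t <= T ->
    (\int[@lebesgue_measure R \x @lebesgue_measure R
        \x @lebesgue_measure R]_(a in unit_cube)
      (density (txyz t (pt3 a)))%:E = c%:E)%E.
  apply: (conservation_law T0 (G := flux) (g := dflux)).
  - apply: within_continuousD; apply: within_continuousZ.
      by apply: within_continuous_sum => j; exact: within_continuousM.
    by apply: within_continuous_sum => j; exact: within_continuousM.
  - move=> m; apply: within_continuousZ; apply: within_continuousB;
      exact: within_continuousM.
  - move=> m; apply: within_continuousZ.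
    by apply: within_continuousB; apply: within_continuousD;
      apply: within_continuousM => //; exact: cont1.
  - exact: poynting.
  - exact: flux_line_derivative.
  - move=> m q Dq qb; rewrite /flux.
    have [m1 m2] := ord3_add_neq m.
    have [mw|mw] := eqVneq w m.
      rewrite -mw in qb m1 m2 *.
      by rewrite !(tangential_B qb _ Dq)// !mulr0 subrr mulr0.
    by rewrite !(tangential_A qb mw _ Dq)// !mul0r subrr mulr0.
exists c => t tT; rewrite -(ec t tT) /energy_wt cylinder_box.
have -> : [set a : R * R * R | cube (pt3 a)] = unit_cube.
  by apply/seteqP; split => a /=; [move/cube_pt3|move=> ?; apply/cube_pt3].
by under eq_integral do rewrite densityE.
Qed.

End fields.

End maxwell.

Theorem theorem2p2 (R : realType) (T eps mu : R)
    (T_gt0 : 0 < T) (eps_gt0 : 0 < eps) (mu_gt0 : 0 < mu)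
    (E H : 'rV[R]_(1 + 3) -> 'rV[R]_3)
    (E_C3 : vCk 3 (cylinder T) E) (H_C3 : vCk 3 (cylinder T) H)
    (EH_maxwell : maxwell T eps mu E H)
    (EH_pec : pec T E H) :
  forall w : 'I_3, exists c : R,
    forall t : R, 0 <= t <= T -> energy_wt T eps mu E H w t = c%:E.
Proof.
move=> w; rewrite cylinder_box in E_C3 H_C3.
exact: energy_constant.
Qed.
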